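(* Let $n\ge 1$. If $(\mathfrak{h},u,v)\in A_{n,n}$, then the Lie algebra $\mathfrak{r}_{2,n}\ltimes_{u,v}\mathfrak{h}$ is unimodular. Every unimodular integrable LCK Lie algebra of dimension $2n+2$ is isomorphic, as an LCK Lie algebra, to $\mathfrak{r}_{2,n}\ltimes_{u,v}\mathfrak{h}$ for some $(\mathfrak{h},u,v)\in A_{n,n}$.
   Context: Lie algebras are real and finite-dimensional; the Chevalley-Eilenberg differential is $d\alpha(X,Y)=-\alpha([X,Y])$ on $1$-forms and $d\Omega(X,Y,Z)=-\Omega([X,Y],Z)-\Omega([Y,Z],X)-\Omega([Z,X],Y)$ on $2$-forms. An almost Hermitian structure on a Lie algebra is a pair $(g,J)$ with $g$ an inner product, $J^2=-\mathrm{Id}$, $g(JX,JY)=g(X,Y)$; its fundamental $2$-form is $\Omega(X,Y)=g(X,JY)$. $J$ is integrable if $N_J(X,Y)=[JX,JY]-[X,Y]-J[JX,Y]-J[X,JY]=0$ for all $X,Y$. The structure is Kähler if $J$ is integrable and $d\Omega=0$; it is LCK with Lee form $\theta$ if $J$ is integrable, $d\Omega=\theta\wedge\Omega$ and $d\theta=0$. With $\eta(X)=-\theta(JX)$, an LCK Lie algebra is integrable if $\eta\wedge d\eta=0$. By rescaling the metric, LCK Lie algebras are always assumed to satisfy $|\theta|=1$. An isomorphism of LCK Lie algebras is a Lie algebra isomorphism preserving $g$ and $J$. A Lie algebra is unimodular if $\mathrm{tr}(\mathrm{ad}_X)=0$ for all $X$. For $c\in\mathbb R$, $\mathfrak{r}_{2,c}$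 is the Lie algebra with basis $U,V$ and bracket $[U,V]=cV$, with $U,V$ orthonormal, $JU=V$, $JV=-U$. For a Kähler Lie algebra $\mathfrak h$ with derivations $u,v$ such that $[u,v]=cv$, $\mathfrak{r}_{2,c}\ltimes_{u,v}\mathfrak h$ is the semidirect product with $[U,Y]=uY$, $[V,Y]=vY$ for $Y\in\mathfrak h$, with the product (orthogonal direct sum) almost Hermitian structure. $A_{n,c}$ is the class of triples $(\mathfrak h,u,v)$ where $\mathfrak h$ is an abelian Kähler Lie algebra of dimension $2n$ and $u,v$ are derivations of $\mathfrak h$ (i.e. arbitrary linear endomorphisms) satisfying $$[u,v]=cv,\quad [v+uJ,J]=0,\quad v^*J+Jv=0,\quad J+u^*J+Ju=0,$$ where $J$ is the complex structure of $\mathfrak h$ and $x^*$ is the adjoint of $x$ with respect to the inner product of $\mathfrak h$. (For such triples $\mathfrak{r}_{2,c}\ltimes_{u,v}\mathfrak h$ is an integrable LCK Lie algebra with Lee form $g(U,\cdot)$.) *)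

(* Defs.v *)
From HB Require Import structures.
From mathcomp Require Import all_boot all_order all_algebra.
From mathcomp Require Import reals ring.

Set Implicit Arguments.
Unset Strict Implicit.
Unset Printing Implicit Defensive.

Import Order.TTheory GRing.Theory Num.Theory.
Local Open Scope ring_scope.

(* Reduces an identity in a vector space to identities in the scalar field. *)
Lemma eq_covec (R : fieldType) (V : vectType R) (x y : V) :
  (forall phi : {scalar V}, phi x = phi y) -> x = y.
Proof.
move=> h; rewrite (coord_vbasis (memvf x)) (coord_vbasis (memvf y)).
apply: eq_bigr => i _; congr (_ *: _).
exact: (h (coord (vbasis {:V}%VS) i)).
Qed.

Record lieAlgebra (R : realType) := LieAlgebra {
  lie_sort :> vectType R;
  br : {bilinear lie_sort -> lie_sort -> lie_sort};
  br_alt : forall X, br X X = 0;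
  br_jacobi : forall X Y Z,
    br X (br Y Z) + br Y (br Z X) + br Z (br X Y) = 0
}.

Arguments br {R l}.

(* An almost Hermitian structure (g, J) = (metric, cpx) on a Lie algebra;
   [{dot _ for idfun}] is the type of positive definite symmetric forms. *)
Record hermLie (R : realType) := HermLie {
  herm_lie :> lieAlgebra R;
  metric : {dot herm_lie for idfun};
  cpx : 'End(herm_lie);
  cpx_sq : forall X, cpx (cpx X) = - X;
  cpx_metric : forall X Y, metric (cpx X) (cpx Y) = metric X Y
}.

Arguments metric {R h}.
Arguments cpx {R} h.

Section LieAlgebraNotions.
Variables (R : realType) (L : lieAlgebra R).
Implicit Types (X Y Z : L) (f h D : 'End(L)).

Lemma br_anti X Y : br X Y = - br Y X.
Proof.
apply/eqP; rewrite -addr_eq0; apply/eqP.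
have := br_alt (X + Y).
by rewrite linearDl !linearDr !br_alt add0r addr0.
Qed.

Definition ad X : 'End(L) := linfun (br X).

(* The trace does not depend on the chosen basis. *)
Definition endo_tr f : R :=
  \tr (passmx.mxof (vbasis {:L}%VS) (vbasis {:L}%VS) f).

Definition unimodular := forall X, endo_tr (ad X) = 0.

Definition abelian_lie := forall X Y, br X Y = 0.

Definition derivation D := forall X Y, D (br X Y) = br (D X) Y + br X (D Y).

Definition endo_comm f h : 'End(L) := (f \o h)%VF - (h \o f)%VF.

(* Chevalley-Eilenberg differential of 1-forms and of 2-forms, and the wedge
   product of a 1-form and a 2-form, with no normalizing factor. *)
Definition diff1 (alpha : L -> R) X Y : R := - alpha (br X Y).

Definition diff2 (omega : L -> L -> R) X Y Z : R :=
  - omega (br X Y) Z - omega (br Y Z) X - omega (br Z X) Y.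

Definition wedge12 (alpha : L -> R) (omega : L -> L -> R) X Y Z : R :=
  alpha X * omega Y Z + alpha Y * omega Z X + alpha Z * omega X Y.

End LieAlgebraNotions.

Section HermitianNotions.
Variables (R : realType) (L : hermLie R).
Implicit Types (X Y Z : L) (f : 'End(L)) (theta : 'Hom(L, R^o)).

Let J := cpx L.

Lemma metricC X Y : metric X Y = metric Y X.
Proof. by rewrite hermC /= expr0 mul1r. Qed.

Definition flat1 X : L -> R^o := fun Y => metric X Y.

Lemma flat1_linear X : linear (flat1 X).
Proof. by move=> a Y Z; rewrite /flat1 linearPr. Qed.
HB.instance Definition _ X :=
  GRing.isLinear.Build R L R^o *:%R (flat1 X) (flat1_linear X).

Definition flat_fun X : 'Hom(L, R^o) := linfun (flat1 X).

Lemma flat_fun_linear : linear flat_fun.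
Proof.
move=> a X Y; apply/lfunP=> Z; do !rewrite !lfunE /=.
by rewrite /flat1 linearPl.
Qed.
HB.instance Definition _ :=
  GRing.isLinear.Build R L 'Hom(L, R^o) *:%R flat_fun flat_fun_linear.

(* The musical isomorphisms X |-> g(X, _) and its inverse. *)
Definition flat : 'Hom(L, 'Hom(L, R^o)) := linfun flat_fun.
Definition sharp theta : L := (flat^-1)%VF theta.

Lemma flatE X Y : flat X Y = metric X Y.
Proof. by do !rewrite lfunE /=. Qed.

Lemma lker_flat : lker flat == 0%VS.
Proof.
apply/eqP/vspaceP=> X; rewrite memv_ker memv0; apply/eqP/eqP=> [fX|->].
  apply/eqP/negP => /negP /(@neq0_dnorm_gt0 _ _ _ (@metric R L)).
  by rewrite -flatE fX lfunE /= ltxx.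
exact: linear0.
Qed.

Lemma sharpK theta : flat (sharp theta) = theta.
Proof.
apply: limg_lfunVK; suff -> : limg flat = fullv by rewrite memvf.
apply/eqP; rewrite eqEdim subvf /= limg_dim_eq ?(eqP lker_flat) ?capv0 //.
by rewrite !dimvf /dim /= muln1.
Qed.

Lemma sharpE theta X : metric (sharp theta) X = theta X.
Proof. by rewrite -flatE sharpK. Qed.

Definition adjoint_fun f Y : L := sharp (flat Y \o f)%VF.

Lemma adjoint_fun_linear f : linear (adjoint_fun f).
Proof.
move=> a X Y; rewrite /adjoint_fun /sharp.
by rewrite linearP comp_lfunDl -comp_lfunZl linearP.
Qed.
HB.instance Definition _ f :=
  GRing.isLinear.Build R L L *:%R (adjoint_fun f) (adjoint_fun_linear f).

Definition adjoint f : 'End(L) := linfun (adjoint_fun f).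

Lemma adjointP f X Y : metric (f X) Y = metric X (adjoint f Y).
Proof.
by rewrite [RHS]metricC lfunE /= sharpE lfunE /= flatE metricC.
Qed.

Definition covector_norm theta : R :=
  Num.sqrt (metric (sharp theta) (sharp theta)).

Definition fundamental_form X Y : R := metric X (J Y).

Definition nijenhuis X Y : L :=
  br (J X) (J Y) - br X Y - J (br (J X) Y) - J (br X (J Y)).

Definition integrable_cpx := forall X Y, nijenhuis X Y = 0.

Record kahler : Prop := Kahler {
  kahler_integrable : integrable_cpx;
  kahler_closed : forall X Y Z, diff2 fundamental_form X Y Z = 0
}.

(* LCK with Lee form theta, normalized so that |theta| = 1. *)
Record lck theta : Prop := Lck {
  lck_cpx : integrable_cpx;
  lck_lee : forall X Y Z,
    diff2 fundamental_form X Y Z = wedge12 theta fundamental_form X Y Z;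
  lck_closed : forall X Y, diff1 theta X Y = 0;
  lck_normalized : covector_norm theta = 1
}.

(* The 1-form eta = - theta o J. *)
Definition anti_lee theta X : R := - theta (J X).

Definition lck_integrable theta := forall X Y Z,
  wedge12 (anti_lee theta) (diff1 (anti_lee theta)) X Y Z = 0.

End HermitianNotions.

(* Isomorphism of Lie algebras preserving g and J; when the source is LCK then
   so is the target, with the corresponding Lee form. *)
Definition lck_isomorphic (R : realType) (L M : hermLie R) : Prop :=
  exists f : 'Hom(L, M),
    [/\ bijective f,
        forall X Y, f (br X Y) = br (f X) (f Y),
        forall X Y, metric (f X) (f Y) = metric X Y
      & forall X, f (cpx L X) = cpx M (f X)].

(* Semidirect product of g and h along rho : g -> Der(h), with the orthogonal
   direct sum almost Hermitian structure. *)
Section SemidirectProduct.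
Variables (R : realType) (g h : hermLie R).
Variable rho : 'Hom(g, 'End(h)).
Hypothesis rho_der : forall X, derivation (rho X).
Hypothesis rho_br : forall X Y, rho (br X Y) = endo_comm (rho X) (rho Y).

Let V : vectType R := (g * h)%type.

Definition sd_br (x y : V) : V :=
  (br x.1 y.1, rho x.1 y.2 - rho y.1 x.2 + br x.2 y.2).


Lemma sd_br_bilinear : bilinear_for *:%R *:%R sd_br.
Proof.
split=> [y a x x'|x a y y']; rewrite /sd_br; congr pair; apply: eq_covec => phi /=.
- by rewrite linearPl.
- rewrite linearPl linearP linearP /= !lfunE /= lfunE /=.
  rewrite !(linearD, linearB, linearN) /= !linearZ /=.
  rewrite ?(linearD, linearB, linearN) /= ?linearZ /=; ring.
- by rewrite linearPr.
- rewrite linearPr linearP linearP /= !lfunE /= lfunE /=.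
  rewrite !(linearD, linearB, linearN) /= !linearZ /=.
  rewrite ?(linearD, linearB, linearN) /= ?linearZ /=; ring.
Qed.

HB.instance Definition _ :=
  bilinear_isBilinear.Build R V V V *:%R *:%R sd_br sd_br_bilinear.

Lemma sd_alt x : sd_br x x = 0.
Proof. by congr pair; rewrite /= br_alt // subrr addr0. Qed.

Lemma sd_jacobi x y z :
  sd_br x (sd_br y z) + sd_br y (sd_br z x) + sd_br z (sd_br x y) = 0.
Proof.
congr pair; rewrite /=; first exact: br_jacobi.
have jac := br_jacobi x.2 y.2 z.2.
apply: eq_covec => phi.
have {jac} := congr1 phi jac.
rewrite !linearD !linearN /= !rho_br !rho_der.
rewrite /endo_comm !lfunE /= !lfunE /= !lfunE /= !(linearD, linearN) /=.
rewrite (br_anti (rho x.1 y.2)) (br_anti (rho y.1 z.2)) (br_anti (rho z.1 x.2)).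
rewrite !(linearD, linearN) /= => jac.
rewrite -jac; ring.
Qed.

Definition sd_lie : lieAlgebra R := LieAlgebra sd_alt sd_jacobi.

Definition sd_metric (x y : V) : R := metric x.1 y.1 + metric x.2 y.2.

Lemma sd_metric_bilinear : bilinear_for *%R *%R sd_metric.
Proof.
by split=> [y a x x'|x a y y']; rewrite /sd_metric /= ?linearPl ?linearPr /=; ring.
Qed.
HB.instance Definition _ :=
  bilinear_isBilinear.Build R V V R *%R *%R sd_metric sd_metric_bilinear.

Lemma sd_metric_sym x y :
  sd_metric x y = (-1) ^+ false * idfun (sd_metric y x).
Proof.
by rewrite expr0 mul1r /sd_metric (metricC x.1) (metricC x.2).
Qed.

Lemma sd_metric_pos x : x != 0 -> 0 < sd_metric x x.
Proof.
have ge0 (L : hermLie R) (a : L) : 0 <= metric a a.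
  have [->|/neq0_dnorm_gt0] := eqVneq a 0; first by rewrite linear0.
  by move=> /(_ _ (@metric R L)) /ltW.
have [x1|nx1 _] := eqVneq x.1 0.
  have [x2|nx2 _] := eqVneq x.2 0.
    by case: x x1 x2 => /= ? ? -> ->; rewrite eqxx.
  rewrite ltr_wpDl ?ge0 //; exact: (neq0_dnorm_gt0 (s := @metric R h)).
rewrite ltr_pwDl ?ge0 //; exact: (neq0_dnorm_gt0 (s := @metric R g)).
Qed.

HB.instance Definition _ :=
  @isHermitianSesquilinear.Build R V false idfun sd_metric sd_metric_sym.
HB.instance Definition _ := isDotProduct.Build R V sd_metric sd_metric_pos.

Definition sd_cpx_fun (x : V) : V := (cpx g x.1, cpx h x.2).

Lemma sd_cpx_linear : linear sd_cpx_fun.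
Proof. by move=> a x y; congr pair; rewrite /= linearP. Qed.
HB.instance Definition _ :=
  GRing.isLinear.Build R V V *:%R sd_cpx_fun sd_cpx_linear.

Definition sd_cpx : 'End(V) := linfun sd_cpx_fun.

Lemma sd_cpx_sq x : sd_cpx (sd_cpx x) = - x.
Proof. by do !rewrite lfunE /=; rewrite /sd_cpx_fun /= !cpx_sq. Qed.

Lemma sd_cpx_metric x y : sd_metric (sd_cpx x) (sd_cpx y) = sd_metric x y.
Proof. by do !rewrite lfunE /=; rewrite /sd_metric /= !cpx_metric. Qed.

Definition semidirect : hermLie R :=
  @HermLie R sd_lie sd_metric sd_cpx sd_cpx_sq sd_cpx_metric.

End SemidirectProduct.

(* r_{2,c}: the pair (a, b) stands for a U + b V. *)
Section R2.
Variables (R : realType) (c : R).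

Let V : vectType R := (R^o * R^o)%type.

Definition r2_U : V := (1, 0).
Definition r2_V : V := (0, 1).

Definition r2_br (x y : V) : V := (x.1 * y.2 - x.2 * y.1) *: (c *: r2_V).

Lemma r2_br_bilinear : bilinear_for *:%R *:%R r2_br.
Proof.
split=> [y a x x'|x a y y']; rewrite /r2_br /= !scalerA -scalerDl;
  congr (_ *: _); rewrite /= /GRing.scale /=; ring.
Qed.
HB.instance Definition _ :=
  bilinear_isBilinear.Build R V V V *:%R *:%R r2_br r2_br_bilinear.

Lemma r2_alt x : r2_br x x = 0.
Proof. by rewrite /r2_br mulrC subrr scale0r. Qed.

Lemma r2_jacobi x y z :
  r2_br x (r2_br y z) + r2_br y (r2_br z x) + r2_br z (r2_br x y) = 0.
Proof.
rewrite /r2_br -!scalerDl -[RHS](scale0r (c *: r2_V)); congr (_ *: _).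
rewrite /= /GRing.scale /=; ring.
Qed.

Definition r2_lie : lieAlgebra R := LieAlgebra r2_alt r2_jacobi.

Definition r2_metric (x y : V) : R := x.1 * y.1 + x.2 * y.2.

Lemma r2_metric_bilinear : bilinear_for *%R *%R r2_metric.
Proof.
by split=> [y a x x'|x a y y']; rewrite /r2_metric /= /GRing.scale /=; ring.
Qed.
HB.instance Definition _ :=
  bilinear_isBilinear.Build R V V R *%R *%R r2_metric r2_metric_bilinear.

Lemma r2_metric_sym x y :
  r2_metric x y = (-1) ^+ false * idfun (r2_metric y x).
Proof. by rewrite expr0 mul1r /r2_metric /=; ring. Qed.

Lemma r2_metric_pos x : x != 0 -> 0 < r2_metric x x.
Proof.
case: x => a b ab0; rewrite lt_neqAle addr_ge0 ?sqr_ge0 ?andbT //=.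
rewrite eq_sym; apply: contra ab0.
rewrite /r2_metric /= paddr_eq0 ?sqr_ge0 // !mulf_eq0 !orbb.
by case/andP=> /eqP-> /eqP->.
Qed.

HB.instance Definition _ :=
  @isHermitianSesquilinear.Build R V false idfun r2_metric r2_metric_sym.
HB.instance Definition _ := isDotProduct.Build R V r2_metric r2_metric_pos.

Definition r2_cpx_fun (x : V) : V := (- x.2, x.1).

Lemma r2_cpx_linear : linear r2_cpx_fun.
Proof.
by move=> a x y; congr pair; rewrite /= /GRing.scale /=; ring.
Qed.
HB.instance Definition _ :=
  GRing.isLinear.Build R V V *:%R r2_cpx_fun r2_cpx_linear.

Definition r2_cpx : 'End(V) := linfun r2_cpx_fun.

Lemma r2_cpx_sq x : r2_cpx (r2_cpx x) = - x.
Proof. by do !rewrite lfunE /=. Qed.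

Lemma r2_cpx_metric x y : r2_metric (r2_cpx x) (r2_cpx y) = r2_metric x y.
Proof. by do !rewrite lfunE /=; rewrite /r2_metric /=; ring. Qed.

Definition r2 : hermLie R :=
  @HermLie R r2_lie r2_metric r2_cpx r2_cpx_sq r2_cpx_metric.

Lemma r2_brUV : br (r2_U : r2) (r2_V : r2) = c *: (r2_V : r2).
Proof.
by rewrite /= /r2_br /= mulr1 mul0r subr0 scale1r.
Qed.

Lemma r2_cpxU : cpx r2 r2_U = r2_V.
Proof. by rewrite /= lfunE /= /r2_cpx_fun /= oppr0. Qed.

Lemma r2_cpxV : cpx r2 r2_V = - (r2_U : r2).
Proof. by rewrite -r2_cpxU cpx_sq. Qed.

End R2.

Record r2_action (R : realType) (c : R) (h : hermLie R) (u v : 'End(h)) : Prop :=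
  R2Action {
    action_kahler : kahler h;
    action_deru : derivation u;
    action_derv : derivation v;
    action_comm : endo_comm u v = c *: v
  }.

Section R2Ltimes.
Variables (R : realType) (c : R) (h : hermLie R) (u v : 'End(h)).
Hypothesis uvP : r2_action c u v.

Definition r2_rho_fun (x : r2 c) : 'End(h) := x.1 *: u + x.2 *: v.

Lemma r2_rho_linear : linear r2_rho_fun.
Proof.
move=> a x y; rewrite /r2_rho_fun scalerDr addrACA !scalerA.
by rewrite -!scalerDl.
Qed.
HB.instance Definition _ :=
  GRing.isLinear.Build R (r2 c) 'End(h) *:%R r2_rho_fun r2_rho_linear.

Definition r2_rho : 'Hom(r2 c, 'End(h)) := linfun r2_rho_fun.

Lemma r2_rho_der X : derivation (r2_rho X).
Proof.
move=> Y Z; rewrite lfunE /r2_rho_fun; do ![rewrite !lfunE /=].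
rewrite (action_deru uvP) (action_derv uvP) !scalerDr.
by rewrite linearDl linearDr !linearZl_LR !linearZr_LR addrACA.
Qed.

Lemma r2_rho_br X Y : r2_rho (br X Y) = endo_comm (r2_rho X) (r2_rho Y).
Proof.
apply/lfunP=> Z; rewrite !lfunE /r2_rho_fun /=.
have /lfunP/(_ Z) := action_comm uvP.
rewrite /endo_comm; do ![rewrite !lfunE /=] => E.
apply: eq_covec => phi; have := congr1 phi E.
rewrite !(linearD, linearN, linearZ) /=.
rewrite ?(linearD, linearN, linearZ) /= /GRing.scale /= => F.
rewrite (canRL (subrK _) F); move: X.1 X.2 Y.1 Y.2 => a b a' b'; ring.
Qed.

Definition r2_ltimes : hermLie R := semidirect r2_rho_der r2_rho_br.

End R2Ltimes.

Record classA (R : realType) (n : nat) (c : R) (h : hermLie R) (u v : 'End(h))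
    : Prop := ClassA {
  classA_action :> r2_action c u v;
  classA_abelian : abelian_lie h;
  classA_dim : dim h = (2 * n)%N;
  classA_uv : endo_comm (v + (u \o cpx h)%VF) (cpx h) = 0;
  classA_v : (adjoint v \o cpx h)%VF + (cpx h \o v)%VF = 0;
  classA_u : cpx h + (adjoint u \o cpx h)%VF + (cpx h \o u)%VF = 0
}.

(* Main.v *)
From HB Require Import structures.
Require Import Defs.
From mathcomp Require Import all_boot all_order all_algebra.
From mathcomp Require Import reals ring lra zify.

Set Implicit Arguments.
Unset Strict Implicit.
Unset Printing Implicit Defensive.

Import Order.TTheory GRing.Theory Num.Theory.
Local Open Scope ring_scope.

(** For unimodularity of [r2_ltimes] only two traces matter, since the ideal is
abelian: [ad U] has trace [c + tr u] and [ad V] has trace [tr v]. The equations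
of [classA] say [u* = J u J - 1] and [v* = J v J], and [tr (J f J) = - tr f],
so [tr u = - n] and [tr v = 0] (lemmas [endo_tr_u], [endo_tr_v]); with [c = n]
everything cancels.

Conversely, let [U] be the vector dual to the Lee form, [V = J U], and [h] the
orthogonal complement of the plane they span. Evaluating the axioms on
[U], [V] and [h] shows that [h] is an ideal, that [[U, V] = c V], and that
[u = ad U], [v = ad V] satisfy on [h] all the equations of [classA]
([assemble_iso], [fibre_uv], [fibre_v_adj], [fibre_u_adj]). Unimodularity and
the trace formulas force [c = n] and make [h] unimodular. What remains is that
[h] is abelian ([fibre_abelian]).

For [n = 1], a unimodular Lie algebra of dimension 2 is abelian. For [n >= 2]
the argument is spectral. Write [u = A + B - 1/2] with [A] skew and [B]
symmetric, and [v = J (B - C)]. The equations make [A] and [C] commute with [J]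
and [B] anticommute with it, and make [C] symmetric, and [[u, v] = n v] splits
into its [J]-linear and [J]-antilinear parts ([part_comm]):
  [[A, C] = n C - 2 B^2],    [[A, B] = n B - (B C + C B)].
Both commutators are symmetric, and cyclicity of the trace gives
[tr [A, C]^2 + 2 tr [A, B]^2 = 0], so both vanish ([commutator_rigidity]).
Hence [n C = 2 B^2] and [4 B^3 = n^2 B]: the eigenvalues of [B] lie in
[{0, n/2, -n/2}] and [A] preserves the eigenspaces. Since [u] is a derivation,
a component of the bracket on eigenspaces of weights [p], [q] with values in
weight [r] can be nonzero only if [p + q - r = 1/2] ([bracket_weight]). But
[p + q - r] is an integer multiple of [n/2], and [n z = 1] has no integer
solution when [n >= 2]. *)

(** * Metric, frames and traces *)

Section MetricTheory.
Variables (R : realType) (L : hermLie R).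
Implicit Types (X Y Z : L) (f k : 'End(L)) (s : seq L).

Lemma metricDl X Y Z : metric (X + Y) Z = metric X Z + metric Y Z.
Proof. by rewrite linearDl. Qed.

Lemma metricDr X Y Z : metric X (Y + Z) = metric X Y + metric X Z.
Proof. by rewrite linearDr. Qed.

Lemma metricNl X Y : metric (- X) Y = - metric X Y.
Proof. by rewrite linearNl. Qed.

Lemma metricNr X Y : metric X (- Y) = - metric X Y.
Proof. by rewrite linearNr. Qed.

Lemma metricZl a X Y : metric (a *: X) Y = a * metric X Y.
Proof. by rewrite linearZl_LR. Qed.

Lemma metricZr a X Y : metric X (a *: Y) = a * metric X Y.
Proof. by rewrite linearZr_LR. Qed.

Definition metric_lin := (metricDl, metricDr, metricNl, metricNr, metricZl, metricZr).

Lemma metric0l X : metric 0 X = 0. Proof. by rewrite linear0l. Qed.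

Lemma metric0r X : metric X 0 = 0. Proof. by rewrite linear0r. Qed.

Lemma metric_suml I (r : seq I) (F : I -> L) Y :
  metric (\sum_(i <- r) F i) Y = \sum_(i <- r) metric (F i) Y.
Proof. by rewrite linear_sumlz. Qed.

Lemma metric_gt0 X : X != 0 -> 0 < metric X X.
Proof. exact: neq0_dnorm_gt0. Qed.

Lemma metric_ge0 X : 0 <= metric X X.
Proof. by have [->|/metric_gt0/ltW//] := eqVneq X 0; rewrite metric0l. Qed.

Lemma metric_eq0 X : metric X X = 0 -> X = 0.
Proof.
by move=> X0; apply/eqP; apply/negPn/negP => /metric_gt0; rewrite X0 ltxx.
Qed.

Lemma metric_inj X Y : (forall Z, metric X Z = metric Y Z) -> X = Y.
Proof.
move=> XY; apply/eqP; rewrite -subr_eq0; apply/eqP/metric_eq0.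
by rewrite metricDl metricNl XY subrr.
Qed.

Lemma unit_multiple X : X != 0 -> exists a, metric (a *: X) (a *: X) = 1.
Proof.
move=> X0; have X1 := metric_gt0 X0; exists (Num.sqrt (metric X X))^-1.
rewrite !metric_lin mulrA -invfM -expr2 sqr_sqrtr ?ltW //.
by rewrite mulVf // gt_eqF.
Qed.

Lemma cpx_skew X Y : metric (cpx L X) Y = - metric X (cpx L Y).
Proof. by rewrite -[LHS]cpx_metric cpx_sq metricNl. Qed.

(** Frames replace orthonormal bases: the reconstruction formula alone computes
traces and inner products, and it passes directly to isometric images and
orthogonal sums. *)
Definition frame s := forall X, X = \sum_(e <- s) metric X e *: e.

(** Gram-Schmidt, one unit vector at a time: the part of [W] orthogonal to a
unit vector [w1] of [W] has smaller dimension. *)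
Lemma subspace_frame (W : {vspace L}) :
  exists s, {subset s <= W} /\
    {in W, forall X, X = \sum_(e <- s) metric X e *: e}.
Proof.
move: {2}(\dim W) (leqnn (\dim W)) => d; elim: d W => [|d IH] W dW.
  exists [::]; split=> // X; rewrite big_nil.
  by move: dW; rewrite leqn0 dimv_eq0 => /eqP->; rewrite memv0 => /eqP.
have [W0|nW0] := eqVneq W 0%VS; first by apply: IH; rewrite W0 dimv0.
have [w1 w1W w11] : exists2 w1, w1 \in W & metric w1 w1 = 1.
  have [|a a1] := @unit_multiple (vpick W); first by rewrite vpick0.
  by exists (a *: vpick W); rewrite // memvZ // memv_pick.
pose W' := (W :&: lker (@flat R L w1))%VS.
have W'P X : (X \in W') = (X \in W) && (metric w1 X == 0).
  by rewrite memv_cap memv_ker flatE.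
have [|s [sW' sP]] := IH W'.
  rewrite -ltnS; apply: leq_trans dW.
  have sub : (W' <= W)%VS by exact: capvSl.
  rewrite (ltn_leqif (dimv_leqif_eq sub)); apply/eqP => WW'.
  by have := w1W; rewrite -WW' W'P w11 oner_eq0 andbF.
exists (w1 :: s); split=> [e|X XW].
  by rewrite inE => /predU1P[->|/sW']//; rewrite W'P => /andP[].
have /sP : X - metric X w1 *: w1 \in W'.
  rewrite W'P !metric_lin w11 mulr1 metricC subrr eqxx andbT.
  by apply: rpredB => //; apply: rpredZ.
rewrite big_cons => /(canRL (subrK _)) {1}->; rewrite addrC; congr (_ + _).
rewrite big_seq [RHS]big_seq; apply: eq_bigr => e /sW'.
rewrite W'P => /andP[_ /eqP w1e].
by rewrite !metric_lin w1e mulr0 subr0.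
Qed.

Lemma frame_exists : exists s, frame s.
Proof.
have [s [_ sP]] := subspace_frame fullv.
by exists s => X; apply: sP; rewrite memvf.
Qed.

Lemma frame_expand s X Y : frame s ->
  metric X Y = \sum_(e <- s) metric X e * metric Y e.
Proof.
move=> sP; rewrite {1}(sP X) metric_suml; apply: eq_bigr => e _.
by rewrite metricZl (metricC e).
Qed.

(** Expand each basis vector [f b_i] in the frame, exchange the two sums, and
recognize [e] from its coordinates in the basis. *)
Lemma endo_tr_frame s f : frame s -> endo_tr f = \sum_(e <- s) metric (f e) e.
Proof.
move=> sP; pose b := vbasis {:L}%VS.
have co i : passmx.mxof b b f i i = coord b i (f b`_i).
  rewrite mxE /= /passmx.rVof mxE /passmx.vecof; congr (coord b i (f _)).
  rewrite (bigD1 i) //= mxE !eqxx scale1r big1 ?addr0 // => j ji.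
  by rewrite mxE (negPf ji) andbF scale0r.
rewrite /endo_tr /mxtrace (eq_bigr _ (fun i _ => co i)).
under eq_bigr do rewrite (sP (f _)) linear_sum /=.
rewrite exchange_big /=; apply: eq_bigr => e _.
transitivity (metric (f (\sum_i coord b i e *: b`_i)) e); last first.
  by rewrite -(coord_vbasis (memvf e)).
rewrite linear_sum metric_suml; apply: eq_bigr => i _.
by rewrite !linearZ /= metricZl mulrC.
Qed.

Lemma endo_trD f k : endo_tr (f + k) = endo_tr f + endo_tr k.
Proof.
have [s sP] := frame_exists; rewrite !(endo_tr_frame _ sP) -big_split.
by apply: eq_bigr => e _; rewrite lfunE metricDl.
Qed.

Lemma endo_trZ a f : endo_tr (a *: f) = a * endo_tr f.
Proof.
have [s sP] := frame_exists; rewrite !(endo_tr_frame _ sP) mulr_sumr.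
by apply: eq_bigr => e _; rewrite lfunE metricZl.
Qed.

Lemma endo_trN f : endo_tr (- f) = - endo_tr f.
Proof. by rewrite -scaleN1r endo_trZ mulN1r. Qed.

Lemma endo_tr1 : endo_tr (\1%VF : 'End(L)) = (dim L)%:R.
Proof.
rewrite /endo_tr passmx.mxof1 ?mxtrace1 ?dimvf //.
exact: basis_free (vbasisP _).
Qed.

Lemma endo_trC f k : endo_tr (f \o k)%VF = endo_tr (k \o f)%VF.
Proof.
rewrite /endo_tr; rewrite !(passmx.mxof_comp _ _ (vbasisP _)).
by rewrite mxtrace_mulC.
Qed.

Lemma endo_tr_adjoint f : endo_tr (adjoint f) = endo_tr f.
Proof.
have [s sP] := frame_exists; rewrite !(endo_tr_frame _ sP).
by apply: eq_bigr => e _; rewrite metricC -adjointP.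
Qed.

Definition selfadjoint f := forall X Y, metric (f X) Y = metric X (f Y).

Lemma endo_tr_sq_ge0 f : selfadjoint f -> 0 <= endo_tr (f \o f)%VF.
Proof.
move=> fS; have [s sP] := frame_exists; rewrite (endo_tr_frame _ sP).
by apply: sumr_ge0 => e _; rewrite lfunE /= fS metric_ge0.
Qed.

(** For selfadjoint [f], [tr f^2] is the sum of the [|f e|^2] over a frame. *)
Lemma endo_tr_sq_eq0 f : selfadjoint f -> endo_tr (f \o f)%VF = 0 -> f = 0.
Proof.
move=> fS; have [s sP] := frame_exists; rewrite (endo_tr_frame _ sP).
have ge e : 0 <= metric ((f \o f)%VF e) e by rewrite lfunE /= fS metric_ge0.
move/eqP; rewrite psumr_eq0 // => /allP f0.
apply/lfunP => X; rewrite [X]sP !linear_sum /= big_seq [RHS]big_seq.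
apply: eq_bigr => e /f0 /=; rewrite lfunE /= fS => /eqP/metric_eq0 fe.
by rewrite !linearZ /= fe lfunE /=.
Qed.

End MetricTheory.

(** * Rigidity of the commutators *)

Section Rigidity.
Variables (R : realType) (L : hermLie R).
Implicit Types (A B C : 'End(L)).

Lemma endo_tr_rot A B C : endo_tr (A \o (B \o C))%VF = endo_tr (B \o (C \o A))%VF.
Proof. by rewrite endo_trC comp_lfunA. Qed.

(** By cyclicity [tr ([A, C] C) = 0] and [tr ([A, B] B) = 0], so only the
quadratic terms contribute to the squares:
[tr [A, C]^2 = - 2 tr ([A, C] B^2)] and
[tr [A, B]^2 = - tr ([A, B^2] C) = tr ([A, C] B^2)].
Thus [tr [A, C]^2 + 2 tr [A, B]^2 = 0]. The right-hand sides of the two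
equations are symmetric, so both commutators are selfadjoint and both traces
of squares are nonnegative. *)
Lemma commutator_rigidity (a : R) A B C :
    selfadjoint B -> selfadjoint C ->
    endo_comm A C = a *: C - 2 *: (B \o B)%VF ->
    endo_comm A B = a *: B - ((B \o C) + (C \o B))%VF ->
  endo_comm A C = 0 /\ endo_comm A B = 0.
Proof.
move=> symB symC e1 e2.
have sq1 : endo_tr (endo_comm A C \o endo_comm A C)%VF =
    endo_tr (endo_comm A C \o (a *: C - 2 *: (B \o B)))%VF by rewrite -e1.
have sq2 : endo_tr (endo_comm A B \o endo_comm A B)%VF =
    endo_tr (endo_comm A B \o (a *: B - ((B \o C) + (C \o B))))%VF by rewrite -e2.
have sum0 : endo_tr (endo_comm A C \o endo_comm A C)%VF +
    2 * endo_tr (endo_comm A B \o endo_comm A B)%VF = 0.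
  rewrite sq1 sq2 /endo_comm !comp_lfunDl !comp_lfunDr !comp_lfunNl !comp_lfunNr.
  rewrite -!comp_lfunZr !endo_trD !endo_trN !endo_trZ.
  rewrite !comp_lfunDr !endo_trD.
  rewrite -!comp_lfunA.
  rewrite (endo_tr_rot C A C) (endo_tr_rot B A B).
  rewrite (endo_tr_rot C A (B \o B)) (endo_tr_rot B A (B \o C)) (endo_tr_rot B A (C \o B)).
  rewrite -!comp_lfunA; ring.
(* Symmetry is read off the right-hand sides of the equations. *)
have sD1 : selfadjoint (endo_comm A C).
  move=> X Y; rewrite e1 !(comp_lfunE, scale_lfunE, opp_lfunE, add_lfunE).
  by rewrite !metric_lin !(symB, symC).
have sD2 : selfadjoint (endo_comm A B).
  move=> X Y; rewrite e2 !(comp_lfunE, scale_lfunE, opp_lfunE, add_lfunE).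
  rewrite !metric_lin !(symB, symC); ring.
have := endo_tr_sq_ge0 sD1; have := endo_tr_sq_ge0 sD2 => p1 p2.
by split; apply: endo_tr_sq_eq0 => //; lra.
Qed.

End Rigidity.

(** * Decomposition of the two derivations *)

Section Linearity.
Variables (R : realType) (V W : vectType R).

Lemma lfunD (f : 'Hom(V, W)) x y : f (x + y) = f x + f y.
Proof. exact: linearD. Qed.

Lemma lfunN (f : 'Hom(V, W)) x : f (- x) = - f x.
Proof. exact: linearN. Qed.

Lemma lfunZ (f : 'Hom(V, W)) a x : f (a *: x) = a *: f x.
Proof. exact: linearZ. Qed.

Lemma scalarD (f : {scalar V}) x y : f (x + y) = f x + f y.
Proof. exact: linearD. Qed.

Lemma scalarN (f : {scalar V}) x : f (- x) = - f x.
Proof. exact: linearN. Qed.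

Lemma scalarZ (f : {scalar V}) a x : f (a *: x) = a * f x.
Proof. exact: linearZ. Qed.

End Linearity.

Definition lfun_lin := (lfunD, lfunN, lfunZ).
Definition scalar_lin := (scalarD, scalarN, scalarZ).

Definition lfun_simp := (comp_lfunE, scale_lfunE, opp_lfunE, add_lfunE, id_lfunE).

(** The hypothesis on [A], [B], [C] is one identity between endomorphisms; its
terms with an odd number of factors [B] are [J]-antilinear, the others are
[J]-linear, and the two parts must agree separately. *)
Lemma linear_antilinear_split (R : realType) (h : hermLie R) (a : R)
    (A B C : 'End(h)) :
    (forall X, A (cpx h X) = cpx h (A X)) ->
    (forall X, B (cpx h X) = - cpx h (B X)) ->
    (forall X, C (cpx h X) = cpx h (C X)) ->
    (forall X, A (B X) - A (C X) - 2 *: B (B X) + B (C X) - B (A X)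
       + C (A X) + C (B X) = a *: B X - a *: C X) ->
  endo_comm A C = a *: C - 2 *: (B \o B)%VF /\
  endo_comm A B = a *: B - ((B \o C) + (C \o B))%VF.
Proof.
move=> AJ BJ CJ mixed.
(* Conjugating by [J] changes the sign of each odd occurrence of [B]. *)
have mixedJ X : A (B X) + A (C X) + 2 *: B (B X) + B (C X) - B (A X)
     - C (A X) + C (B X) = a *: B X + a *: C X.
  have := congr1 (cpx h) (mixed (cpx h X)) => e.
  apply: eq_covec => phi; have := congr1 phi e.
  do !rewrite !(lfun_lin, AJ, BJ, CJ, cpx_sq); rewrite !scalar_lin; lra.
split; apply/lfunP=> X; rewrite /endo_comm !lfun_simp; apply: eq_covec => phi;
  have := congr1 phi (mixed X); have := congr1 phi (mixedJ X);
  rewrite !scalar_lin; lra.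
Qed.

Section Pair.
Variables (R : realType) (h : hermLie R) (u v : 'End(h)) (a : R).
Hypothesis uvP : endo_comm u v = a *: v.
Hypothesis uvJ : endo_comm (v + (u \o cpx h)%VF) (cpx h) = 0.
Hypothesis vJ : (adjoint v \o cpx h)%VF + (cpx h \o v)%VF = 0.
Hypothesis uJ : cpx h + (adjoint u \o cpx h)%VF + (cpx h \o u)%VF = 0.
Let J := cpx h.

Lemma adjoint_u X : adjoint u X = J (u (J X)) - X.
Proof.
have /lfunP/(_ (J X)) := uJ.
rewrite !(comp_lfunE, add_lfunE) zero_lfunE !cpx_sq linearN => /eqP.
by rewrite addrAC subr_eq0 => /eqP <-; rewrite addrC.
Qed.

Lemma adjoint_vJ X : adjoint v (J X) = - J (v X).
Proof.
have /lfunP/(_ X) := vJ.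
by rewrite !(comp_lfunE, add_lfunE) zero_lfunE => /eqP; rewrite addr_eq0 => /eqP.
Qed.

Lemma vu_comm X : v (u X) = u (v X) - a *: v X.
Proof.
have /lfunP/(_ X) := uvP; rewrite /endo_comm !lfun_simp => <-.
by rewrite opprB addrC subrK.
Qed.

Lemma vJ_comm X : v (J X) = J (v X) + u X + J (u (J X)).
Proof.
have /lfunP/(_ X) := uvJ; rewrite /endo_comm !lfun_simp zero_lfunE !linearD /=.
rewrite cpx_sq linearN -opprD => /eqP; rewrite subr_eq0 subr_eq => /eqP ->.
by rewrite addrAC.
Qed.

(** The symmetric part of [u + 1/2] and the skew part of [u]: since
[u* = J u J - 1], the shift by [1/2] makes the former anticommute with [J]
while the latter commutes with [J]. *)
Definition sym_part := 2^-1 *: (u + adjoint u + \1)%VF.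
Definition skew_part := 2^-1 *: (u - adjoint u).
(** [J v] is symmetric; adding [sym_part] cancels its [J]-antilinear part. *)
Definition lin_part := sym_part + (J \o v)%VF.

Let A := skew_part.
Let B := sym_part.
Let C := lin_part.

Let AE X : A X = 2^-1 *: (u X - J (u (J X)) + X).
Proof. by rewrite /A /skew_part !lfun_simp adjoint_u opprB addrA addrAC. Qed.

Let BE X : B X = 2^-1 *: (u X + J (u (J X))).
Proof. by rewrite /B /sym_part !lfun_simp adjoint_u addrA subrK. Qed.

Let CE X : C X = 2^-1 *: (u X + J (u (J X))) + J (v X).
Proof. by rewrite [LHS]add_lfunE comp_lfunE -BE. Qed.

Lemma u_decomp X : u X = A X + B X - 2^-1 *: X.
Proof.
by apply: eq_covec => phi; rewrite AE BE !scalar_lin; field.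
Qed.

Lemma adjoint_u_decomp X : adjoint u X = - A X + B X - 2^-1 *: X.
Proof.
by apply: eq_covec => phi; rewrite adjoint_u AE BE !scalar_lin; field.
Qed.

Lemma v_decomp X : v X = J (B X) - J (C X).
Proof. by rewrite CE -BE lfunD cpx_sq opprD opprK addNKr. Qed.

Lemma skew_part_cpx X : A (J X) = J (A X).
Proof.
apply: eq_covec => phi.
by rewrite !AE !lfun_lin !cpx_sq !lfun_lin !scalar_lin; field.
Qed.

Lemma sym_part_cpx X : B (J X) = - J (B X).
Proof.
apply: eq_covec => phi.
by rewrite !BE !lfun_lin !cpx_sq !lfun_lin !scalar_lin; field.
Qed.

(** [[v + u J, J] = 0] says exactly that the [J]-antilinear part of [v] is
[J B]. *)
Lemma lin_part_cpx X : C (J X) = J (C X).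
Proof.
apply: eq_covec => phi.
by rewrite !CE vJ_comm !lfun_lin !cpx_sq !lfun_lin !scalar_lin; field.
Qed.

Lemma sym_partP : selfadjoint B.
Proof.
move=> X Y; rewrite /B /sym_part !lfun_simp !metric_lin -adjointP.
rewrite [metric (adjoint u X) Y]metricC -adjointP (metricC (u Y)); ring.
Qed.

Lemma skew_partP X Y : metric (A X) Y = - metric X (A Y).
Proof.
rewrite /A /skew_part !lfun_simp !metric_lin -adjointP.
rewrite [metric (adjoint u X) Y]metricC -adjointP (metricC (u Y)); ring.
Qed.

Lemma lin_partP : selfadjoint C.
Proof.
move=> X Y; rewrite !(add_lfunE, comp_lfunE) !metric_lin sym_partP; congr (_ + _).
by rewrite cpx_skew adjointP adjoint_vJ metricNr opprK.
Qed.

(** [[u, v] = a v] rewritten with [u = A + B - 1/2] and [v = J (B - C)], once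
[J] has been moved to the left of every term and cancelled. *)
Let comm_mixed X :
  A (B X) - A (C X) - 2 *: B (B X) + B (C X) - B (A X) + C (A X) + C (B X)
  = a *: B X - a *: C X.
Proof.
suff: J (A (B X) - A (C X) - 2 *: B (B X) + B (C X) - B (A X) + C (A X) + C (B X))
    = J (a *: B X - a *: C X).
  by move=> /(congr1 J); rewrite !cpx_sq => /oppr_inj.
have := vu_comm X; rewrite !v_decomp !u_decomp => e.
apply: eq_covec => phi; have := congr1 phi e.
rewrite !lfun_lin !(skew_part_cpx, sym_part_cpx, lin_part_cpx) ?lfun_lin.
rewrite !scalar_lin => {}e; lra.
Qed.

Lemma part_comm :
  endo_comm A C = a *: C - 2 *: (B \o B)%VF /\
  endo_comm A B = a *: B - ((B \o C) + (C \o B))%VF.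
Proof.
exact: linear_antilinear_split skew_part_cpx sym_part_cpx lin_part_cpx comm_mixed.
Qed.
End Pair.

Section Traces.
Variables (R : realType) (h : hermLie R) (u v : 'End(h)).
Hypothesis vJ : (adjoint v \o cpx h)%VF + (cpx h \o v)%VF = 0.
Hypothesis uJ : cpx h + (adjoint u \o cpx h)%VF + (cpx h \o u)%VF = 0.

Lemma endo_tr_conj_cpx (f : 'End(h)) :
  endo_tr (cpx h \o (f \o cpx h))%VF = - endo_tr f.
Proof.
rewrite endo_tr_rot -endo_trN; congr endo_tr.
by apply/lfunP=> X; rewrite !lfun_simp cpx_sq lfunN.
Qed.

(** Here [u* = J u J - 1], hence [tr u = - tr u - dim h]. *)
Lemma endo_tr_u : 2 * endo_tr u = - (dim h)%:R.
Proof.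
have := endo_tr_adjoint u.
have -> : adjoint u = (cpx h \o (u \o cpx h))%VF - \1%VF.
  by apply/lfunP=> X; rewrite (adjoint_u uJ) !lfun_simp.
by rewrite endo_trD endo_trN endo_tr1 endo_tr_conj_cpx => e; lra.
Qed.

(** Here [v* = J v J], hence [tr v = - tr v]. *)
Lemma endo_tr_v : endo_tr v = 0.
Proof.
have := endo_tr_adjoint v.
have -> : adjoint v = (cpx h \o (v \o cpx h))%VF.
  apply/lfunP=> X; have := adjoint_vJ vJ (cpx h X).
  by rewrite cpx_sq lfunN => /oppr_inj ->; rewrite !lfun_simp.
by rewrite endo_tr_conj_cpx => e; lra.
Qed.

End Traces.

(** * Weights and vanishing of the bracket *)

Section Frames.
Variables (R : realType) (h : hermLie R) (s : seq h).
Hypothesis sP : frame s.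

Lemma form_frame (phi : h -> R) :
    (forall X Y, phi (X + Y) = phi X + phi Y) ->
    (forall a X, phi (a *: X) = a * phi X) ->
  forall X, phi X = \sum_(e <- s) metric X e * phi e.
Proof.
move=> phiD phiZ X; rewrite [in LHS](sP X).
elim: s => [|e s' IH]; rewrite ?big_nil ?big_cons; last by rewrite phiD phiZ IH.
by rewrite -(scale0r 0) phiZ mul0r.
Qed.

(** The transpose of a skew endomorphism is skew on linear forms, so it moves
every form [phi] orthogonally to [phi]. *)
Lemma skew_form_frame (A : 'End(h)) (phi : h -> R) :
    (forall X Y, metric (A X) Y = - metric X (A Y)) ->
    (forall X Y, phi (X + Y) = phi X + phi Y) ->
    (forall a X, phi (a *: X) = a * phi X) ->
  \sum_(e <- s) phi (A e) * phi e = 0.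
Proof.
move=> skA phiD phiZ; set S := \sum_(e <- s) _.
suff : S = - S by lra.
have SE : S = \sum_(e <- s) \sum_(e' <- s) metric (A e) e' * phi e' * phi e.
  by apply: eq_bigr => e _; rewrite [phi (A e)]form_frame // mulr_suml.
rewrite {1}SE exchange_big SE -sumrN; apply: eq_bigr => e _.
rewrite -sumrN; apply: eq_bigr => e' _ /=.
by rewrite skA metricC mulrAC; ring.
Qed.

End Frames.

Lemma triple_sumsq_eq0 (R : realDomainType) (I : eqType) (s : seq I)
    (f : I -> I -> I -> R) :
    \sum_(x <- s) \sum_(y <- s) \sum_(z <- s) f x y z ^+ 2 = 0 ->
  {in s & & , forall x y z, f x y z = 0}.
Proof.
have ge1 x y : 0 <= \sum_(z <- s) f x y z ^+ 2.
  by apply: sumr_ge0 => z _; exact: sqr_ge0.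
have ge2 x : 0 <= \sum_(y <- s) \sum_(z <- s) f x y z ^+ 2.
  by apply: sumr_ge0 => y _; exact: ge1.
move/eqP; rewrite psumr_eq0 // => /allP s0 x y z /s0 /=.
rewrite psumr_eq0 // => /allP {}s0 /s0 /=.
rewrite psumr_eq0 => [/allP {}s0 /s0 /=|? _]; last exact: sqr_ge0.
by rewrite sqrf_eq0 => /eqP.
Qed.

Section Weights.
Variables (R : realType) (h : hermLie R) (D A B : 'End(h)) (d : R).
Hypothesis D_der : derivation D.
Hypothesis DE : forall X, D X = A X + B X - d *: X.
Hypothesis DadjE : forall X, adjoint D X = - A X + B X - d *: X.
Hypothesis skewA : forall X Y, metric (A X) Y = - metric X (A Y).

(** Let [T X Y Z] be the component of the bracket under study. Moving the
derivation [D] across the metric gives [(p + q - r - d) T + A.T = 0], where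
[A.T] is the sum of the insertions of [A] in each of the three slots. [A] is
skew, hence so is its action on trilinear forms, and a skew operator has no
nonzero real eigenvalue: pairing the relation with [T], that is, summing over a
frame in each slot, leaves [(p + q - r - d) |T|^2 = 0]. *)
Lemma bracket_weight (P Q S : 'End(h)) (p q r : R) :
    (forall X, A (P X) = P (A X)) -> (forall X, A (Q X) = Q (A X)) ->
    (forall X, A (S X) = S (A X)) ->
    (forall X, B (P X) = p *: P X) -> (forall X, B (Q X) = q *: Q X) ->
    (forall X, B (S X) = r *: S X) ->
    p + q - r != d ->
  forall X Y Z, metric (br (P X) (Q Y)) (S Z) = 0.
Proof.
move=> AP AQ AS BP BQ BS pqr.
pose T X Y Z := metric (br (P X) (Q Y)) (S Z).
have TE X Y Z : (p + q - r - d) * T X Y Z + T (A X) Y Z + T X (A Y) Z + T X Y (A Z) = 0.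
  have := adjointP D (br (P X) (Q Y)) (S Z).
  rewrite D_der DadjE !DE AP AQ AS BP BQ BS.
  rewrite -!addrA -!scalerBl !(linearDl, linearDr, linearZl_LR, linearZr_LR, linearNr) /=.
  rewrite /T; lra.
have [s sP] := frame_exists h.
have T0 : {in s & & , forall X Y Z, T X Y Z = 0}.
  apply: triple_sumsq_eq0.
  have nz : p + q - r - d != 0 by rewrite subr_eq0.
  (* [A.T] is orthogonal to [T], slot by slot. *)
  have s1 : \sum_(X <- s) \sum_(Y <- s) \sum_(Z <- s) T (A X) Y Z * T X Y Z = 0.
    rewrite exchange_big big1 // => Y _; rewrite exchange_big big1 // => Z _.
    apply: (skew_form_frame sP) => // [X X'|a X].
      by rewrite /T lfunD linearDl metricDl.
    by rewrite /T lfunZ linearZl_LR metricZl.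
  have s2 : \sum_(X <- s) \sum_(Y <- s) \sum_(Z <- s) T X (A Y) Z * T X Y Z = 0.
    rewrite big1 // => X _; rewrite exchange_big big1 // => Z _.
    apply: (skew_form_frame sP) => // [Y Y'|a Y].
      by rewrite /T lfunD linearDr metricDl.
    by rewrite /T lfunZ linearZr_LR metricZl.
  have s3 : \sum_(X <- s) \sum_(Y <- s) \sum_(Z <- s) T X Y (A Z) * T X Y Z = 0.
    rewrite big1 // => X _; rewrite big1 // => Y _.
    apply: (skew_form_frame sP) => // [Z Z'|a Z].
      by rewrite /T lfunD metricDr.
    by rewrite /T lfunZ metricZr.
  apply: (mulfI nz); rewrite mulr0.
  suff : (p + q - r - d) * \sum_(X <- s) \sum_(Y <- s) \sum_(Z <- s) T X Y Z ^+ 2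
    + \sum_(X <- s) \sum_(Y <- s) \sum_(Z <- s) T (A X) Y Z * T X Y Z
    + \sum_(X <- s) \sum_(Y <- s) \sum_(Z <- s) T X (A Y) Z * T X Y Z
    + \sum_(X <- s) \sum_(Y <- s) \sum_(Z <- s) T X Y (A Z) * T X Y Z = 0.
    by rewrite s1 s2 s3 !addr0.
  rewrite mulr_sumr -!big_split big1 //= => X _.
  rewrite mulr_sumr -!big_split big1 //= => Y _.
  rewrite mulr_sumr -!big_split big1 //= => Z _.
  by rewrite expr2 mulrA -!mulrDl TE mul0r.
move=> X Y Z; rewrite -/(T X Y Z).
(* From the frame to all vectors, one slot after the other. *)
have vanish (phi : h -> R) : (forall X Y, phi (X + Y) = phi X + phi Y) ->
    (forall a X, phi (a *: X) = a * phi X) -> {in s, forall e, phi e = 0} ->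
    forall X, phi X = 0.
  move=> phiD phiZ phi0 X'; rewrite (form_frame sP) // big_seq.
  by rewrite big1 // => e es; rewrite phi0 // mulr0.
apply: (vanish (fun X => T X Y Z)) => [X1 X2|a X1|x xs].
- by rewrite /T lfunD linearDl metricDl.
- by rewrite /T lfunZ linearZl_LR metricZl.
apply: (vanish (fun Y => T x Y Z)) => [X1 X2|a X1|y ys].
- by rewrite /T lfunD linearDr metricDl.
- by rewrite /T lfunZ linearZr_LR metricZl.
apply: (vanish (T x y)) => [X1 X2|a X1|z zs]; last exact: T0.
- by rewrite /T lfunD metricDr.
- by rewrite /T lfunZ metricZr.
Qed.

End Weights.

Section Plane.
Variables (R : realType) (h : hermLie R).
Implicit Types (X Y e : h).

Definition rank1_fun e X : h := metric X e *: e.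

Lemma rank1_fun_linear e : linear (rank1_fun e).
Proof. by move=> a X Y; rewrite /rank1_fun metricDl metricZl scalerDl scalerA. Qed.
HB.instance Definition _ e :=
  GRing.isLinear.Build R h h *:%R (rank1_fun e) (rank1_fun_linear e).

Definition rank1 e : 'End(h) := linfun (rank1_fun e).

Lemma rank1E e X : rank1 e X = metric X e *: e.
Proof. by rewrite lfunE. Qed.

Lemma endo_tr_rank1 e : endo_tr (rank1 e) = metric e e.
Proof.
have [s sP] := frame_exists h; rewrite (endo_tr_frame _ sP) (frame_expand e e sP).
by apply: eq_bigr => x _; rewrite rank1E metricZl (metricC x).
Qed.

Lemma metric_cpx_orth X : metric X (cpx h X) = 0.
Proof. have := cpx_skew X X; rewrite metricC => e; lra. Qed.

(** The orthogonal projection [N] along the plane of [e] and [J e] is a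
selfadjoint idempotent with [tr N^2 = tr N = 2 - 1 - 1 = 0], hence zero. *)
Lemma unit_cpx_frame e : dim h = 2 -> metric e e = 1 -> frame [:: e; cpx h e].
Proof.
move=> dimh ee; set e' := cpx h e.
have ee' : metric e e' = 0 by exact: metric_cpx_orth.
have e'e' : metric e' e' = 1 by rewrite cpx_metric.
pose N : 'End(h) := \1%VF - rank1 e - rank1 e'.
have NE X : N X = X - metric X e *: e - metric X e' *: e'.
  by rewrite /N !(add_lfunE, opp_lfunE) id_lfunE !rank1E.
have NN : (N \o N)%VF = N.
  apply/lfunP=> X; rewrite comp_lfunE !NE !metric_lin ee ee' e'e' [metric e' e]metricC.
  by rewrite ee' !mulr1 !mulr0 !subr0 !subrr !scale0r !subr0.
have N0 : N = 0.
  apply: endo_tr_sq_eq0.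
    move=> X Y; rewrite !NE !metric_lin (metricC e Y) (metricC e' Y); ring.
  rewrite NN /N !endo_trD !endo_trN endo_tr1 !endo_tr_rank1 ee e'e' dimh; ring.
move=> X; have := NE X; rewrite N0 zero_lfunE => /esym/eqP.
by rewrite -addrA -opprD subr_eq0 !big_cons big_nil addr0 => /eqP.
Qed.

(** With the orthonormal frame [e], [J e], the traces of [ad e] and [ad (J e)]
are, up to sign, the two coordinates of [[e, J e]]. *)
Lemma unimodular_plane_abelian :
  dim h = 2 -> unimodular h -> abelian_lie h.
Proof.
move=> dimh uni.
have [e ee] : exists e : h, metric e e = 1.
  have [|a a1] := @unit_multiple _ h (vpick {:h}%VS).
    by rewrite vpick0 -dimv_eq0 dimvf dimh.
  by exists (a *: vpick {:h}%VS).
have fr := unit_cpx_frame dimh ee; set e' := cpx h e in fr.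
have trE X : metric (br X e) e + metric (br X e') e' = 0.
  have := uni X; rewrite (endo_tr_frame _ fr) !big_cons big_nil addr0.
  by rewrite !lfunE.
have b1 : metric (br e e') e' = 0.
  by have := trE e; rewrite br_alt metric0l add0r.
have b2 : metric (br e e') e = 0.
  by have := trE e'; rewrite br_alt metric0l addr0 br_anti metricNl => /eqP;
    rewrite oppr_eq0 => /eqP.
have b : br e e' = 0.
  by rewrite (fr (br e e')) !big_cons big_nil b1 b2 !scale0r !addr0.
move=> X Y; rewrite (fr X) (fr Y) !big_cons !big_nil !addr0.
rewrite linearDl !linearDr !linearZl_LR /= !linearZr_LR /= !br_alt (br_anti e' e) b.
by rewrite oppr0 !scaler0 !addr0.
Qed.

End Plane.

(** For [dim h = 2] unimodularity is enough. Otherwise rigidity gives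
[n C = 2 B^2] and [n B = B C + C B], so that [B^3 = k^2 B] with [k = n / 2];
every bracket component between eigenspaces of [B] then vanishes by
[bracket_weight], the obstruction [n (p + q - r) = 1] having no solution in
integers. *)
Lemma fibre_abelian (R : realType) (n : nat) (h : hermLie R) (u v : 'End(h)) :
    (1 <= n)%N -> dim h = (2 * n)%N -> unimodular h -> derivation u ->
    endo_comm u v = n%:R *: v ->
    endo_comm (v + (u \o cpx h)%VF) (cpx h) = 0 ->
    (adjoint v \o cpx h)%VF + (cpx h \o v)%VF = 0 ->
    cpx h + (adjoint u \o cpx h)%VF + (cpx h \o u)%VF = 0 ->
  abelian_lie h.
Proof.
move=> n1 dimh uni uder uv uvJ vJ uJ.
have [n2|n_le1] := leqP 2 n; last first.
  by apply: unimodular_plane_abelian => //; rewrite dimh; lia.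
have [cAC cAB] := part_comm uv uvJ uJ.
have [AC0 AB0] := commutator_rigidity (sym_partP u) (lin_partP u vJ) cAC cAB.
have DE := u_decomp uJ; have DadjE := adjoint_u_decomp uJ.
have skA := skew_partP u.
move: (skew_part u) (sym_part u) (lin_part u v) cAC cAB AC0 AB0 DE DadjE skA.
move=> A B C; rewrite /endo_comm => cAC cAB AC0 AB0 DE DadjE skA.
set a : R := n%:R in uv cAC cAB.
have a0 : a != 0 by rewrite pnatr_eq0; lia.
have AB X : A (B X) = B (A X).
  have /lfunP/(_ X) := AB0; rewrite zero_lfunE !lfun_simp => /eqP.
  by rewrite subr_eq0 => /eqP.
have CE X : a *: C X = 2 *: B (B X).
  have /lfunP/(_ X) := cAC; rewrite AC0 zero_lfunE !lfun_simp => /esym/eqP.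
  by rewrite subr_eq0 => /eqP.
have BE X : a *: B X = B (C X) + C (B X).
  have /lfunP/(_ X) := cAB; rewrite AB0 zero_lfunE !lfun_simp => /esym/eqP.
  by rewrite subr_eq0 => /eqP.
pose k := a / 2.
have k0 : k != 0 by rewrite mulf_neq0 // invr_eq0 pnatr_eq0.
have B3 X : B (B (B X)) = k ^+ 2 *: B X.
  have e : a *: (a *: B X) = 4 *: B (B (B X)).
    rewrite BE scalerDr CE -lfunZ CE lfunZ -scalerDl; congr (_ *: _); ring.
  have -> : B (B (B X)) = 4^-1 *: (4 *: B (B (B X))).
    by rewrite scalerA mulVf ?scale1r // pnatr_eq0.
  by rewrite -e !scalerA; congr (_ *: _); rewrite /k; field.
(* Weights are counted in units of [k = n / 2], so that the exceptional case
   of [bracket_weight] becomes an equation in integers. *)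
pose weight (P : 'End(h)) := exists z : int,
  (forall X, A (P X) = P (A X)) /\ (forall X, B (P X) = (k * z%:~R) *: P X).
have vanish P Q S : weight P -> weight Q -> weight S ->
    forall X Y Z, metric (br (P X) (Q Y)) (S Z) = 0.
  move=> [p [AP BP]] [q [AQ BQ]] [r [AS BS]].
  apply: (bracket_weight uder DE DadjE skA AP AQ AS BP BQ BS).
  apply/eqP => pqr.
  have : (n%:Z * (p + q - r)%R)%:~R = 1%:~R :> R.
    rewrite !(intrM, intrD, intrN) /=; move: pqr; rewrite /k /a => e.
    rewrite -[n%:~R]/(n%:R).
    lra.
  by move/intr_inj/(congr1 absz)/eqP; rewrite abszM muln_eq1 absz_nat; lia.
(* Since [B^3 = k^2 B], Lagrange interpolation at [k], [-k], [0] gives the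
   spectral projections of [B] as polynomials in [B]. *)
pose Ppos : 'End(h) := (2 * k ^+ 2)^-1 *: ((B \o B)%VF + k *: B).
pose Pneg : 'End(h) := (2 * k ^+ 2)^-1 *: ((B \o B)%VF - k *: B).
pose Pzero : 'End(h) := \1%VF - (k ^+ 2)^-1 *: (B \o B)%VF.
have PposE X : Ppos X = (2 * k ^+ 2)^-1 *: (B (B X) + k *: B X) by rewrite !lfun_simp.
have PnegE X : Pneg X = (2 * k ^+ 2)^-1 *: (B (B X) - k *: B X) by rewrite !lfun_simp.
have PzeroE X : Pzero X = X - (k ^+ 2)^-1 *: B (B X) by rewrite !lfun_simp.
have w1 : weight Ppos.
  exists 1; split=> X; first by rewrite !PposE !lfun_lin !AB.
  apply: eq_covec => phi; rewrite mulr1z !PposE !lfun_lin B3 !scalar_lin.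
  by field.
have w2 : weight Pneg.
  exists (-1); split=> X; first by rewrite !PnegE !lfun_lin !AB.
  apply: eq_covec => phi; rewrite mulrN1z !PnegE !lfun_lin B3 !scalar_lin.
  by field.
have w3 : weight Pzero.
  exists 0; split=> X; first by rewrite !PzeroE !lfun_lin !AB.
  apply: eq_covec => phi; rewrite mulr0z !PzeroE !lfun_lin B3 !scalar_lin.
  by field.
have dec X : X = Ppos X + Pneg X + Pzero X.
  apply: eq_covec => phi; rewrite PposE PnegE PzeroE !scalar_lin.
  by field.
have v1 P Q : weight P -> weight Q -> forall X Y, br (P X) (Q Y) = 0.
  move=> wP wQ X Y; apply: metric_inj => Z; rewrite metric0l (dec Z) !metricDr.
  by rewrite !vanish // !addr0.
have v2 P : weight P -> forall X Y, br (P X) Y = 0.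
  by move=> wP X Y; rewrite (dec Y) !linearDr /= !v1 // !addr0.
by move=> X Y; rewrite (dec X) !linearDl /= !v2 // !addr0.
Qed.

(** * Traces on semidirect products *)

Section SemidirectTrace.
Variables (R : realType) (g h : hermLie R) (rho : 'Hom(g, 'End(h))).
Hypothesis rho_der : forall X, derivation (rho X).
Hypothesis rho_br : forall X Y, rho (br X Y) = endo_comm (rho X) (rho Y).
Let M := semidirect rho_der rho_br.

Lemma semidirect_frame (sg : seq g) (sh : seq h) : frame sg -> frame sh ->
  @frame R M ([seq (x, 0) | x <- sg] ++ [seq (0, y) | y <- sh]).
Proof.
move=> fg fh [x y]; rewrite big_cat !big_map /=.
have {1}-> : ((x, y) : M) = (x, 0) + (0, y).
  by congr pair; rewrite ?addr0 ?add0r.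
congr (_ + _).
  transitivity ((\sum_(e <- sg) metric x e *: e, 0) : M).
    by congr pair; exact: fg.
  rewrite (big_morph (fun x => (x, 0) : M) (id1 := 0) (op1 := +%R)) //; last first.
    by move=> x1 x2; congr pair; rewrite addr0.
  apply: eq_bigr => e _; congr pair => /=; last by rewrite scaler0.
  by rewrite /sd_metric /= metric0r addr0.
transitivity ((0, \sum_(e <- sh) metric y e *: e) : M).
  by congr pair; exact: fh.
rewrite (big_morph (fun x => (0, x) : M) (id1 := 0) (op1 := +%R)) //; last first.
  by move=> x1 x2; congr pair; rewrite addr0.
apply: eq_bigr => e _; congr pair => /=; first by rewrite scaler0.
by rewrite /sd_metric /= metric0r add0r.
Qed.

(** In the splitting of the product, [ad x] is block triangular with diagonal
blocks [ad x.1] and [rho x.1 + ad x.2]. *)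
Lemma endo_tr_ad_semidirect (x : M) :
  endo_tr (ad x) = endo_tr (ad x.1) + endo_tr (rho x.1) + endo_tr (ad x.2).
Proof.
have [sg fg] := frame_exists g; have [sh fh] := frame_exists h.
rewrite (endo_tr_frame _ (semidirect_frame fg fh)) (endo_tr_frame _ fg).
rewrite !(endo_tr_frame _ fh) big_cat !big_map -addrA -big_split /=; congr (_ + _).
  apply: eq_bigr => e _; rewrite !lfunE /= /sd_metric /=.
  by rewrite metric0r addr0.
apply: eq_bigr => e _; rewrite !lfunE /= /sd_metric /=.
by rewrite metric0r add0r linear0 lfunE /= subr0 metricDl.
Qed.

End SemidirectTrace.

Section R2Trace.
Variables (R : realType) (c : R).

Lemma r2_frame : @frame R (r2 c) [:: r2_U R; r2_V R].
Proof.
move=> [a b]; rewrite !big_cons big_nil /= /r2_metric /=.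
by congr pair; rewrite /= /GRing.scale /=; ring.
Qed.

Lemma endo_tr_ad_r2 (x : r2 c) : endo_tr (ad x) = c * x.1.
Proof.
rewrite (endo_tr_frame _ r2_frame) !big_cons big_nil !lfunE /=.
rewrite /r2_metric /r2_br /= /GRing.scale /=; ring.
Qed.

Variables (h : hermLie R) (u v : 'End(h)).
Hypothesis uvP : r2_action c u v.

Lemma endo_tr_ad_r2_ltimes (x : r2_ltimes uvP) :
  endo_tr (ad x) =
  (c + endo_tr u) * x.1.1 + endo_tr v * x.1.2 + endo_tr (ad x.2).
Proof.
rewrite endo_tr_ad_semidirect endo_tr_ad_r2; congr (_ + _).
rewrite [r2_rho _ _ _ _]lfunE /= /r2_rho_fun endo_trD !endo_trZ; ring.
Qed.

End R2Trace.

Lemma endo_tr_ad_abelian (R : realType) (h : hermLie R) (X : h) :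
  abelian_lie h -> endo_tr (ad X) = 0.
Proof.
move=> ab; have [s sP] := frame_exists h; rewrite (endo_tr_frame _ sP).
by rewrite big1 // => e _; rewrite lfunE /= ab metric0l.
Qed.

Lemma classA_unimodular (R : realType) (n : nat) (h : hermLie R) (u v : 'End(h))
  (uvA : classA n n%:R u v) : unimodular (r2_ltimes uvA).
Proof.
move=> x; rewrite endo_tr_ad_r2_ltimes endo_tr_ad_abelian; last exact: classA_abelian uvA.
have := endo_tr_u (classA_u uvA); rewrite (classA_dim uvA) natrM => tru.
rewrite (endo_tr_v (classA_v uvA)).
have -> : endo_tr u = - n%:R by lra.
ring.
Qed.

(** A map preserving the metric is injective, so surjectivity is all that has to
be checked; the direction is chosen so that the map is given by a formula on
the semidirect product, while its inverse is the isomorphism wanted. *)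
Lemma lck_isomorphic_inv (R : realType) (L M : hermLie R) (F : 'Hom(M, L)) :
    (forall X Y, F (br X Y) = br (F X) (F Y)) ->
    (forall X Y, metric (F X) (F Y) = metric X Y) ->
    (forall X, F (cpx M X) = cpx L (F X)) ->
    (forall Y, exists X, F X = Y) ->
  lck_isomorphic L M.
Proof.
move=> Fbr Fg FJ Fsurj.
have Finj : lker F == 0%VS.
  apply/lker0P => X Y FXY; apply/eqP; rewrite -subr_eq0; apply/eqP/metric_eq0.
  by rewrite -Fg lfunD lfunN FXY subrr metric0l.
have Flim Y : F (F^-1%VF Y) = Y.
  by have [X <-] := Fsurj Y; rewrite (lker0_lfunK Finj).
exists (F^-1)%VF; split.
- exists F; [exact: Flim | exact: lker0_lfunK].
- by move=> X Y; rewrite -{1}(Flim X) -{1}(Flim Y) -Fbr (lker0_lfunK Finj).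
- by move=> X Y; rewrite -Fg !Flim.
- by move=> X; rewrite -{1}(Flim X) -FJ (lker0_lfunK Finj).
Qed.

(** An isometry carries a frame to a frame, and [ad] is intertwined. *)
Lemma lck_isomorphic_unimodular (R : realType) (L M : hermLie R) :
  lck_isomorphic L M -> unimodular L -> unimodular M.
Proof.
move=> [F [[G GK FK] Fbr Fg FJ]] uni Y.
have [s sP] := frame_exists L.
have sF : frame [seq F e | e <- s].
  move=> Z; rewrite big_map -{1}(FK Z) {1}(sP (G Z)) linear_sum /=.
  by apply: eq_bigr => e _; rewrite lfunZ -{2}(FK Z) Fg.
transitivity (endo_tr (ad (G Y))); last exact: uni.
rewrite (endo_tr_frame _ sF) (endo_tr_frame _ sP) big_map.
by apply: eq_bigr => e _; rewrite !lfunE /= -{1}(FK Y) -Fbr Fg.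
Qed.

(** * Hermitian subalgebras *)

Section SubHermitian.
Variables (R : realType) (L : hermLie R) (W : {vspace L}).
Hypothesis W_br : {in W &, forall X Y, br X Y \in W}.
Hypothesis W_cpx : {in W, forall X, cpx L X \in W}.

Let V : vectType R := subvs_of W.

(** [vsproj] serves only as a partial inverse of [vsval]: as [W] is closed under
the bracket and under [J], what it is applied to already lies in [W]. *)
Definition sub_br (x y : V) : V := vsproj W (br (vsval x) (vsval y)).

Lemma vsval_sub_br x y : vsval (sub_br x y) = br (vsval x) (vsval y).
Proof. by rewrite vsprojK // W_br ?subvsP. Qed.

Lemma sub_br_bilinear : bilinear_for *:%R *:%R sub_br.
Proof.
by split=> [y a x x'|x a y y']; rewrite /sub_br linearP ?linearPl ?linearPr linearP.
Qed.
HB.instance Definition _ :=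
  bilinear_isBilinear.Build R V V V *:%R *:%R sub_br sub_br_bilinear.

Lemma sub_alt x : sub_br x x = 0.
Proof. by rewrite /sub_br br_alt linear0. Qed.

Lemma sub_jacobi x y z :
  sub_br x (sub_br y z) + sub_br y (sub_br z x) + sub_br z (sub_br x y) = 0.
Proof.
by apply: subvs_inj; rewrite !linearD /= !vsval_sub_br br_jacobi.
Qed.

Definition sub_lie : lieAlgebra R := LieAlgebra sub_alt sub_jacobi.

Definition sub_metric (x y : V) : R := metric (vsval x) (vsval y).

Lemma sub_metric_bilinear : bilinear_for *%R *%R sub_metric.
Proof.
by split=> [y a x x'|x a y y']; rewrite /sub_metric linearP ?linearPl ?linearPr.
Qed.
HB.instance Definition _ :=
  bilinear_isBilinear.Build R V V R *%R *%R sub_metric sub_metric_bilinear.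

Lemma sub_metric_sym x y :
  sub_metric x y = (-1) ^+ false * idfun (sub_metric y x).
Proof. by rewrite expr0 mul1r /sub_metric metricC. Qed.

Lemma sub_metric_pos x : x != 0 -> 0 < sub_metric x x.
Proof.
by move=> x0; apply: metric_gt0; rewrite -(inj_eq subvs_inj) in x0.
Qed.

HB.instance Definition _ :=
  @isHermitianSesquilinear.Build R V false idfun sub_metric sub_metric_sym.
HB.instance Definition _ := isDotProduct.Build R V sub_metric sub_metric_pos.

Definition sub_cpx_fun (x : V) : V := vsproj W (cpx L (vsval x)).

Lemma sub_cpx_linear : linear sub_cpx_fun.
Proof. by move=> a x y; rewrite /sub_cpx_fun !linearP. Qed.
HB.instance Definition _ :=
  GRing.isLinear.Build R V V *:%R sub_cpx_fun sub_cpx_linear.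

Definition sub_cpx : 'End(V) := linfun sub_cpx_fun.

Lemma vsval_sub_cpx x : vsval (sub_cpx x) = cpx L (vsval x).
Proof. by rewrite lfunE vsprojK // W_cpx // subvsP. Qed.

Lemma sub_cpx_sq x : sub_cpx (sub_cpx x) = - x.
Proof. by apply: subvs_inj; rewrite !vsval_sub_cpx cpx_sq linearN. Qed.

Lemma sub_cpx_metric x y : sub_metric (sub_cpx x) (sub_cpx y) = sub_metric x y.
Proof. by rewrite /sub_metric !vsval_sub_cpx cpx_metric. Qed.

Definition sub_herm : hermLie R :=
  @HermLie R sub_lie sub_metric sub_cpx sub_cpx_sq sub_cpx_metric.

Lemma sub_herm_brE (x y : sub_herm) : vsval (br x y) = br (vsval x) (vsval y).
Proof. exact: vsval_sub_br. Qed.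

Lemma sub_herm_cpxE (x : sub_herm) : vsval (cpx sub_herm x) = cpx L (vsval x).
Proof. exact: vsval_sub_cpx. Qed.

Lemma sub_herm_metricE (x y : sub_herm) : metric x y = metric (vsval x) (vsval y).
Proof. by []. Qed.

(** [ad Z] restricted to [W], for [Z] in the ambient algebra; meaningful when
[W] is stable under [ad Z]. *)
Definition sub_ad_fun (Z : L) (x : V) : V := vsproj W (br Z (vsval x)).

Lemma sub_ad_linear Z : linear (sub_ad_fun Z).
Proof. by move=> a x y; rewrite /sub_ad_fun !linearP. Qed.
HB.instance Definition _ Z :=
  GRing.isLinear.Build R V V *:%R (sub_ad_fun Z) (sub_ad_linear Z).

Definition sub_ad Z : 'End(sub_herm) := linfun (sub_ad_fun Z).

Lemma sub_adE Z (x : sub_herm) : {in W, forall X, br Z X \in W} ->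
  vsval (sub_ad Z x) = br Z (vsval x).
Proof. by move=> ZW; rewrite lfunE vsprojK // ZW // subvsP. Qed.

End SubHermitian.

Lemma endo_commE (R : realType) (L : lieAlgebra R) (f k : 'End(L)) X :
  endo_comm f k X = f (k X) - k (f X).
Proof. by rewrite add_lfunE opp_lfunE !comp_lfunE. Qed.

(** * Structure of integrable LCK Lie algebras *)

Section BracketLinearity.
Variables (R : realType) (L : lieAlgebra R).
Implicit Types X Y Z : L.

Lemma brDl X Y Z : br (X + Y) Z = br X Z + br Y Z.
Proof. by rewrite linearDl. Qed.

Lemma brDr X Y Z : br X (Y + Z) = br X Y + br X Z.
Proof. by rewrite linearDr. Qed.

Lemma brZl a X Y : br (a *: X) Y = a *: br X Y.
Proof. by rewrite linearZl_LR. Qed.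

Lemma brZr a X Y : br X (a *: Y) = a *: br X Y.
Proof. by rewrite linearZr_LR. Qed.

End BracketLinearity.

Section R2LtimesE.
Variables (R : realType) (c : R) (h : hermLie R) (u v : 'End(h)).
Hypothesis uvP : r2_action c u v.
Implicit Types X Y : r2_ltimes uvP.

Lemma r2_ltimes_brE X Y : br X Y =
  ((0, (X.1.1 * Y.1.2 - X.1.2 * Y.1.1) * c),
   X.1.1 *: u Y.2 + X.1.2 *: v Y.2 - (Y.1.1 *: u X.2 + Y.1.2 *: v X.2)
   + br X.2 Y.2).
Proof.
have rhoE (x : r2 c) z : r2_rho c u v x z = x.1 *: u z + x.2 *: v z.
  by rewrite [r2_rho _ _ _ _]lfunE add_lfunE !scale_lfunE.
rewrite -!rhoE; congr pair; congr pair; rewrite /= /GRing.scale /=; ring.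
Qed.

Lemma r2_ltimes_metricE X Y : metric X Y =
  X.1.1 * Y.1.1 + X.1.2 * Y.1.2 + metric X.2 Y.2.
Proof. by []. Qed.

Lemma r2_ltimes_cpxE X : cpx _ X = ((- X.1.2, X.1.1), cpx h X.2).
Proof. by rewrite [cpx _ X]lfunE; congr pair; rewrite /= lfunE. Qed.

End R2LtimesE.

Section Structure.
Variables (R : realType) (L : hermLie R) (theta : 'Hom(L, R^o)).
Hypothesis Llck : lck theta.
Hypothesis Lint : lck_integrable theta.
Implicit Types (X Y Z : L).

Let J := cpx L.

Definition lee_vector : L := sharp theta.
Definition reeb_vector : L := cpx L lee_vector.
Definition fibre : {vspace L} :=
  (lker (@flat R L lee_vector) :&: lker (@flat R L reeb_vector))%VS.

Let U := lee_vector.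
Let V := reeb_vector.

Lemma fibreP X :
  reflect (metric lee_vector X = 0 /\ metric reeb_vector X = 0) (X \in fibre).
Proof.
rewrite memv_cap !memv_ker !flatE.
by apply: (iffP andP) => [[/eqP ? /eqP]|[-> ->]].
Qed.

Let thetaE X : theta X = metric U X.
Proof. by rewrite sharpE. Qed.

Let UU : metric U U = 1.
Proof.
have := lck_normalized Llck; rewrite /covector_norm -/U => e.
by rewrite -[LHS]sqr_sqrtr ?metric_ge0 // e expr1n.
Qed.

Let VV : metric V V = 1. Proof. by rewrite cpx_metric. Qed.

Let UV : metric U V = 0. Proof. exact: metric_cpx_orth. Qed.

Let JV : J V = - U. Proof. exact: cpx_sq. Qed.

Let metric_VJ X : metric V (J X) = metric U X. Proof. exact: cpx_metric. Qed.

Let metric_UJ X : metric U (J X) = - metric V X.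
Proof. by rewrite cpx_skew opprK. Qed.

Let etaE X : anti_lee theta X = metric V X.
Proof. by rewrite /anti_lee thetaE metric_UJ opprK. Qed.

Let U_br X Y : metric U (br X Y) = 0.
Proof.
by have := lck_closed Llck X Y; rewrite /diff1 thetaE => /eqP; rewrite oppr_eq0 => /eqP.
Qed.

(** [eta] wedge [d eta] on [(V, X, Y)] reduces to [d eta] on [(X, Y)] when
[X] and [Y] are orthogonal to [V], because [eta] is dual to [V] and
[|V| = 1]. *)
Lemma reeb_br X Y : metric reeb_vector X = 0 -> metric reeb_vector Y = 0 ->
  metric reeb_vector (br X Y) = 0.
Proof.
move=> VX VY; have := Lint V X Y.
rewrite /wedge12 /diff1 !etaE VV VX VY !mul0r !addr0 mul1r.
by move/eqP; rewrite oppr_eq0 => /eqP.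
Qed.

Let fibreU X : X \in fibre -> metric U X = 0. Proof. by case/fibreP. Qed.
Let fibreV X : X \in fibre -> metric V X = 0. Proof. by case/fibreP. Qed.

Lemma fibre_br : {in fibre &, forall X Y, br X Y \in fibre}.
Proof.
move=> X Y /fibreV VX /fibreV VY; apply/fibreP; split; first exact: U_br.
exact: reeb_br.
Qed.

Lemma fibre_cpx : {in fibre, forall X, cpx L X \in fibre}.
Proof.
by move=> X /fibreP[UX VX]; apply/fibreP; rewrite metric_VJ metric_UJ VX oppr0.
Qed.

Lemma lee_br_fibre : {in fibre, forall X, br lee_vector X \in fibre}.
Proof.
move=> X /fibreV VX; apply/fibreP; split; first exact: U_br.
by apply: reeb_br => //; rewrite metricC.
Qed.

(* The vanishing of the Nijenhuis tensor on [(U, X)]. *)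
Let nij X :
  br V (J X) = br U X + J (br V X) + J (br U (J X)).
Proof.
have := lck_cpx Llck U X; rewrite /nijenhuis -/J -/V => /eqP.
by rewrite -!addrA -!opprD subr_eq0 !addrA => /eqP.
Qed.

(** The component along [V] is the delicate one: the vanishing of the
Nijenhuis tensor on [(U, J X)] expresses [[V, X]] through [[U, J X]], which lies in [h], and
through [J] of two brackets; these are orthogonal to [V = J U] because every
bracket is orthogonal to [U], the Lee form being closed. *)
Lemma reeb_br_fibre : {in fibre, forall X, br reeb_vector X \in fibre}.
Proof.
move=> X Xf; apply/fibreP; split; first exact: U_br.
have := congr1 (metric V) (nij (J X)).
rewrite cpx_sq linearNr !metricDr !metric_VJ !U_br !addr0 metricNr.
by rewrite (fibreV (lee_br_fibre (fibre_cpx Xf))) => /eqP; rewrite oppr_eq0 => /eqP.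
Qed.

Definition lee_weight := metric reeb_vector (br lee_vector reeb_vector).

Let lee X Y Z :
  - metric (br X Y) (J Z) - metric (br Y Z) (J X) - metric (br Z X) (J Y) =
  metric U X * metric Y (J Z) + metric U Y * metric Z (J X)
  + metric U Z * metric X (J Y).
Proof.
by have := lck_lee Llck X Y Z; rewrite /diff2 /wedge12 /fundamental_form !thetaE.
Qed.

(** If [Z] is the component of [[U, V]] in [h], the equation
[d Omega = theta wedge Omega] on [(U, V, J Z)] says [|Z|^2 = 0]: the other two
brackets lie in [h], hence are orthogonal to [U] and [V]. *)
Lemma lee_br_reeb : br lee_vector reeb_vector = lee_weight *: reeb_vector.
Proof.
rewrite -/U -/V; apply/eqP; rewrite -subr_eq0; apply/eqP.
set Z := _ - _.
have Zf : Z \in fibre.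
  apply/fibreP; rewrite -/U -/V /Z !metric_lin U_br UV VV /lee_weight -/U -/V.
  by split; ring.
apply: metric_eq0; have JZf := fibre_cpx Zf.
have := lee U V (J Z).
rewrite -[J U]/V JV !cpx_sq !metricNr UV UU (fibreV Zf) (fibreU JZf).
rewrite (metricC _ V) (fibreV (reeb_br_fibre JZf)) (metricC _ U) U_br => e.
have -> : metric Z Z = metric (br U V) Z.
  by rewrite {1}/Z metricDl metricNl metricZl (fibreV Zf) mulr0 subr0.
lra.
Qed.

Lemma fibre_decomp X :
  X - metric X lee_vector *: lee_vector - metric X reeb_vector *: reeb_vector \in fibre.
Proof.
apply/fibreP; rewrite -/U -/V !metric_lin !(metricC X) UU VV UV (metricC V U) UV.
by split; ring.
Qed.

Definition fibre_herm : hermLie R := sub_herm fibre_br fibre_cpx.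
Definition fibre_u : 'End(fibre_herm) := sub_ad fibre_br fibre_cpx lee_vector.
Definition fibre_v : 'End(fibre_herm) := sub_ad fibre_br fibre_cpx reeb_vector.

Let h := fibre_herm.
Let u := fibre_u.
Let v := fibre_v.

Let h_inj (x y : h) : vsval x = vsval y -> x = y.
Proof. exact: subvs_inj. Qed.

Let uE (x : h) : vsval (u x) = br U (vsval x).
Proof. exact/sub_adE/lee_br_fibre. Qed.

Let vE (x : h) : vsval (v x) = br V (vsval x).
Proof. exact/sub_adE/reeb_br_fibre. Qed.

Let JE (x : h) : vsval (cpx h x) = J (vsval x).
Proof. exact: sub_herm_cpxE. Qed.

Let brE (x y : h) : vsval (br x y) = br (vsval x) (vsval y).
Proof. exact: sub_herm_brE. Qed.

Let xU (x : h) : metric U (vsval x) = 0. Proof. exact/fibreU/subvsP. Qed.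
Let xV (x : h) : metric V (vsval x) = 0. Proof. exact/fibreV/subvsP. Qed.

Lemma br_derivation X Y Z : br X (br Y Z) = br (br X Y) Z + br Y (br X Z).
Proof.
have /eqP := br_jacobi X Y Z; rewrite -addrA addr_eq0 => /eqP ->.
rewrite (br_anti Z X) (br_anti (br X Y)) linearNr opprD opprK addrC; congr (_ + _).
Qed.

Lemma fibre_action : r2_action lee_weight u v.
Proof.
split.
- split=> [J0 x y|x y z].
    apply: h_inj; rewrite /nijenhuis !linearD !linearN /= !(brE, JE).
    exact: (lck_cpx Llck).
  have := lck_lee Llck (vsval x) (vsval y) (vsval z).
  rewrite /wedge12 !thetaE !xU !mul0r !addr0.
  by rewrite /diff2 /fundamental_form !sub_herm_metricE !(brE, JE).
- by move=> x y; apply: h_inj; rewrite linearD /= !(uE, brE) br_derivation.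
- by move=> x y; apply: h_inj; rewrite linearD /= !(vE, brE) br_derivation.
apply/lfunP=> x; apply: h_inj.
rewrite endo_commE scale_lfunE linearB linearZ /= !(uE, vE).
by rewrite br_derivation addrK lee_br_reeb linearZl_LR.
Qed.

(** The vanishing of the Nijenhuis tensor on [U] and a vector of [h]. *)
Lemma fibre_uv : endo_comm (v + (u \o cpx h)%VF) (cpx h) = 0.
Proof.
apply/lfunP=> x; apply: h_inj; rewrite endo_commE zero_lfunE !add_lfunE !comp_lfunE.
rewrite cpx_sq !lfun_lin !(linearB, linearD, linearN) /= !(uE, vE, JE).
by rewrite nij; apply: eq_covec => phi; rewrite !scalar_lin; ring.
Qed.

(** [d Omega = theta wedge Omega] on [V] and two vectors of [h], where the
right-hand side vanishes. *)
Lemma fibre_v_adj : (adjoint v \o cpx h)%VF + (cpx h \o v)%VF = 0.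
Proof.
apply/lfunP=> x; apply: metric_inj => y.
rewrite zero_lfunE add_lfunE !comp_lfunE metric0l metricDl metricC -adjointP cpx_skew.
rewrite !sub_herm_metricE !(vE, JE); have := lee V (vsval x) (vsval y).
rewrite JV metricNr (metricC _ U) U_br (br_anti (vsval y)) metricNl UV !xU !mul0r.
lra.
Qed.

(** [d Omega = theta wedge Omega] on [U] and two vectors of [h]; the isolated
[J] comes from the right-hand side. *)
Lemma fibre_u_adj : cpx h + (adjoint u \o cpx h)%VF + (cpx h \o u)%VF = 0.
Proof.
apply/lfunP=> x; apply: metric_inj => y.
rewrite zero_lfunE !add_lfunE !comp_lfunE metric0l !metricDl !cpx_skew.
rewrite [metric (adjoint _ _) _]metricC -adjointP.
rewrite !sub_herm_metricE !(uE, JE); have := lee U (vsval x) (vsval y).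
rewrite -[J U]/V (metricC _ V) (fibreV (fibre_br (subvsP x) (subvsP y))).
rewrite (br_anti (vsval y)) metricNl UU !xU !mul0r => e.
lra.
Qed.

Definition assemble_fun (m : r2_ltimes fibre_action) : L :=
  m.1.1 *: U + m.1.2 *: V + vsval m.2.

Lemma assemble_fun_linear : linear assemble_fun.
Proof.
move=> a x y; apply: eq_covec => phi.
rewrite /assemble_fun /= !scalar_lin /= /GRing.scale /=; ring.
Qed.
HB.instance Definition _ :=
  GRing.isLinear.Build R (r2_ltimes fibre_action) L *:%R assemble_fun
    assemble_fun_linear.

Definition assemble : 'Hom(r2_ltimes fibre_action, L) := linfun assemble_fun.

Lemma assembleE m : assemble m = m.1.1 *: U + m.1.2 *: V + vsval m.2.
Proof. by rewrite lfunE. Qed.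

Lemma assemble_iso : lck_isomorphic L (r2_ltimes fibre_action).
Proof.
apply: (@lck_isomorphic_inv _ _ _ assemble).
- move=> x y; rewrite !assembleE r2_ltimes_brE /= !(linearB, linearD, linearZ) /=.
  rewrite !(uE, vE, brE) !(brDl, brDr, brZl, brZr) !br_alt.
  rewrite (br_anti V U) (br_anti (vsval x.2) U) (br_anti (vsval x.2) V) lee_br_reeb.
  apply: eq_covec => phi; rewrite !scalar_lin linear0.
  rewrite /V /GRing.scale /=; ring.
- move=> x y; rewrite !assembleE r2_ltimes_metricE !metric_lin UU VV !xU !xV.
  rewrite (metricC V U) UV !(metricC (vsval x.2)) xU xV (metricC _ (vsval x.2)).
  rewrite sub_herm_metricE; ring.
- move=> x; rewrite !assembleE r2_ltimes_cpxE /= JE !lfunD !lfunZ -[cpx L U]/V JV.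
  by rewrite scaleNr scalerN [X in X + _]addrC.
move=> Y; exists (metric Y U, metric Y V, vsproj fibre (Y - metric Y U *: U - metric Y V *: V)).
rewrite assembleE /= vsprojK ?fibre_decomp //.
by rewrite -[X in _ + X]addrA -opprD subrKC.
Qed.

End Structure.

Lemma lck_isomorphic_dim (R : realType) (L M : hermLie R) :
  lck_isomorphic L M -> dim L = dim M.
Proof.
move=> [F [[G GK FK] _ _ _]].
have Fker : lker F = 0%VS by apply/eqP/lker0P/(can_inj GK).
have Fim : limg F = fullv.
  apply/eqP; rewrite eqEsubv subvf /=.
  by apply/subvP => y _; rewrite -(FK y) memv_img ?memvf.
by rewrite -(dimvf L) -(dimvf M) -Fim limg_dim_eq // Fker capv0.
Qed.

Lemma dim_r2_ltimes (R : realType) (c : R) (h : hermLie R) (u v : 'End(h))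
  (uvP : r2_action c u v) : dim (r2_ltimes uvP) = (2 + dim h)%N.
Proof. by []. Qed.

(** * Unimodular integrable LCK Lie algebras *)

Theorem theorem5p4 (R : realType) (n : nat) (hn : (1 <= n)%N) :
  (forall (h : hermLie R) (u v : 'End(h)) (uvA : classA n n%:R u v),
     unimodular (r2_ltimes uvA))
  /\
  (forall (L : hermLie R) (theta : 'Hom(L, R^o)),
     lck theta -> lck_integrable theta -> unimodular L ->
     dim L = (2 * n + 2)%N ->
     exists (h : hermLie R) (u v : 'End(h)) (uvA : classA n n%:R u v),
       lck_isomorphic L (r2_ltimes uvA)).
Proof.
split=> [h u v uvA|L theta Llck Lint Luni dimL].
  exact: classA_unimodular.
have LM := assemble_iso Llck Lint.
have Muni := lck_isomorphic_unimodular LM Luni.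
have := fibre_uv Llck Lint; have := fibre_v_adj Llck Lint.
have := fibre_u_adj Llck Lint.
have := lck_isomorphic_dim LM; rewrite dimL dim_r2_ltimes.
move: (fibre_action Llck Lint) LM Muni.
move: (fibre_u _ _) (fibre_v _ _) (lee_weight theta).
move: (fibre_herm _ _) => h u v c uvP LM Muni dimM uJ vJ uvJ.
have dimh : dim h = (2 * n)%N by lia.
have tr x := etrans (esym (endo_tr_ad_r2_ltimes x)) (Muni x).
(* [ad] of an element of the ideal [h] has the same trace on [h]. *)
have huni : unimodular h.
  by move=> X; have := tr ((0, 0), X); rewrite /= !mulr0 !add0r.
(* [0 = tr (ad U) = c + tr u]. *)
have cn : c = n%:R.
  have := tr ((1, 0), 0); have := endo_tr_u uJ; rewrite dimh natrM /= huni.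
  lra.
subst c.
have hab : abelian_lie h.
  exact: fibre_abelian (action_deru uvP) (action_comm uvP) uvJ vJ uJ.
exists h, u, v, (ClassA uvP hab dimh uvJ vJ uJ).
exact: LM.
Qed.
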